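(* Let $\lambda_1=(1+\sqrt5)/2$ and let $p_0,p_1>0$ with $p_0+p_1=1$. For any $n\in\mathbb{N}_0$, consider the function $\phi_n\colon\mathbb{R}\to\mathbb{R}_{\ge0}$ defined by $$\phi_n(k):=\frac{1}{L_n}\,\mathbb{V}\bigl(X_n(k)\bigr).$$ On $\mathbb{R}$, the sequence $(\phi_n)_{n\in\mathbb{N}_0}$ converges uniformly to the continuous function $\phi\colon\mathbb{R}\to\mathbb{R}_{\ge0}$ with $$\phi(k):=\frac{2p_0p_1\lambda_1}{\sqrt5}\sum_{i=2}^{\infty}\lambda_1^{-i}\,\Psi_i(k).$$
   Context: The sequence $L_n$ is given by $L_0=1$, $L_1=\lambda_1$, $L_n=L_{n-1}+L_{n-2}$ for $n\ge2$ (so $L_n=\lambda_1^n$). For $k\in\mathbb{R}$, the complex random variables $X_n(k)$ are defined by $X_0(k)=\mathrm{e}^{-2\pi\mathrm{i}k}$, $X_1(k)=\mathrm{e}^{-2\pi\mathrm{i}k\lambda_1}$ and, for $n\ge2$, $$X_n(k)=\begin{cases}X_{n-2}(k)+\mathrm{e}^{-2\pi\mathrm{i}kL_{n-2}}X_{n-1}(k), & \text{with probability } p_0,\\ X_{n-1}(k)+\mathrm{e}^{-2\pi\mathrm{i}kL_{n-1}}X_{n-2}(k), & \text{with probability } p_1,\end{cases}$$ where this is understood as a recursion for the distribution of $X_n(k)$: the variables $X_{n-1}(k)$ and $X_{n-2}(k)$ entering the right-hand side are independent of each other and of the choice between the two cases. $\mathbb{E}$ denotes expectation, $\mathbb{E}_n=\mathbb{E}(X_n(k))$,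 and $\mathbb{V}(X_n(k))=\mathbb{E}(|X_n(k)|^2)-|\mathbb{E}(X_n(k))|^2$. Thus $\mathbb{E}_n=(p_1+p_0\mathrm{e}_{n-2})\mathbb{E}_{n-1}+(p_0+p_1\mathrm{e}_{n-1})\mathbb{E}_{n-2}$ for $n\ge2$, where $\mathrm{e}_n:=\mathrm{e}^{-2\pi\mathrm{i}kL_n}$. For $n\ge2$, $$\Psi_n(k):=\tfrac12\bigl|(1-\mathrm{e}_{n-2})\mathbb{E}_{n-1}-(1-\mathrm{e}_{n-1})\mathbb{E}_{n-2}\bigr|^2.$$ *)

(* Defs.v *)
From HB Require Import structures.
From mathcomp Require Import all_boot all_order all_algebra.
From mathcomp Require Import all_classical all_reals all_analysis.
From mathcomp Require Export complex.

Set Implicit Arguments.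
Unset Strict Implicit.
Unset Printing Implicit Defensive.

Import Order.TTheory GRing.Theory Num.Theory.
Import numFieldNormedType.Exports.

Local Open Scope classical_set_scope.
Local Open Scope ring_scope.
Local Open Scope complex_scope.

Definition complex_pair (R : Type) (z : R[i]) : R * R :=
  (complex.Re z, complex.Im z).

HB.instance Definition _ (R : realType) := isPointed.Build R[i] 0.

(* The Borel sigma-algebra of C: the preimages of the measurable sets of R * R. *)
HB.instance Definition _ (R : realType) :=
  Measurable.copy R[i] (g_sigma_algebra_preimageType (@complex_pair R)).

Section inflation.
Variable R : realType.

Definition lambda1 : R := (1 + Num.sqrt 5) / 2.

Fixpoint Lseq (n : nat) : R :=
  match n with
  | 0 => 1
  | m.+1 => match m with
            | 0 => lambda1
            | l.+1 => Lseq m + Lseq l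
            end
  end.

(* exp(- 2 pi i x) *)
Definition phase (x : R) : R[i] := cos (2 * pi * x) -i* sin (2 * pi * x).

Definition phaseL (k : R) (n : nat) : R[i] := phase (k * Lseq n).

(* [mu n] is the law of X_n(k).  The product measure [mu n.+1 \x mu n] is the
   joint law of an independent pair [yz] with the laws of X_{n+1}(k), X_n(k);
   as the choice between the two cases is independent of this pair, the law of
   X_{n+2}(k) is the mixture, with weights p0 and p1, of its two images. *)
Definition inflation_laws (p0 p1 k : R) (mu : nat -> probability R[i] R) :=
  [/\ forall A : set R[i], measurable A -> mu 0%N A = \d_(phase k) A,
      forall A : set R[i], measurable A -> mu 1%N A = \d_(phase (k * lambda1)) A
    & forall (n : nat) (A : set R[i]), measurable A ->
        mu n.+2 A =
        (p0%:E * (mu n.+1 \x mu n)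
           [set yz : R[i] * R[i] | A (yz.2 + phaseL k n * yz.1)%R] +
         p1%:E * (mu n.+1 \x mu n)
           [set yz : R[i] * R[i] | A (yz.1 + phaseL k n.+1 * yz.2)%R])%E].

Section moments.
Context {d : measure_display} {T : measurableType d}.

Definition cexpectation (P : probability T R) (X : T -> R[i]) : R[i] :=
  fine 'E_P[fun w => complex.Re (X w)] +i* fine 'E_P[fun w => complex.Im (X w)].

Definition cvariance (P : probability T R) (X : T -> R[i]) : R :=
  fine 'E_P[fun w => Normc.normc (X w) ^+ 2] -
  Normc.normc (cexpectation P X) ^+ 2.

End moments.

(* [E n] is the expectation of X_n(k).  Meaningful only for 2 <= n, where the
   subtractions are not truncated. *)
Definition Psi (k : R) (E : nat -> R[i]) (n : nat) : R :=
  2^-1 * Normc.normc ((1 - phaseL k (n - 2)) * E (n - 1)%N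
                      - (1 - phaseL k (n - 1)) * E (n - 2)%N) ^+ 2.

End inflation.

Arguments lambda1 {R}.

(* Main.v *)
(* Every law is a finite sum of weighted point masses, so all moments are finite
   sums.  Splitting the variance of the mixture defining X_n into the part inside
   and the part between the two cases gives V_n = V_(n-1) + V_(n-2) + 2 p0 p1 Psi_n,
   with V_0 = V_1 = 0.  The quantity D_n = (1 - e_(n-2)) E_(n-1) - (1 - e_(n-1)) E_(n-2)
   in Psi_n = |D_n|^2 / 2 satisfies D_(n+1) = - (p0 + p1 e_(n-1)) D_n because
   e_n = e_(n-1) e_(n-2); hence |D_n| is nonincreasing and Psi_n <= 8 uniformly in
   n and k.  Diagonalising the Fibonacci recursion then gives V_n / L_n as the nth
   partial sum of the series for phi, up to O(lambda1^-n) uniformly in k. *)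

Require Import Defs.
From HB Require Import structures.
From mathcomp Require Import all_boot all_order all_algebra.
From mathcomp Require Import all_classical all_reals all_analysis.
From mathcomp Require Import measurable_realfun ring lra.
Import Order.TTheory GRing.Theory Num.Theory.
Import numFieldNormedType.Exports.
Local Open Scope classical_set_scope.
Local Open Scope ring_scope.

(** * Measurability of complex-valued maps, by coordinates *)

Section complex_measurability.
Context {R : realType}.

Lemma measurable_complex_pair :
  measurable_fun [set: R[i]] (@complex_pair R).
Proof. by move=> _ B mB; exists B. Qed.

Lemma measurable_Re : measurable_fun [set: R[i]] (@complex.Re R).
Proof. exact: measurableT_comp measurable_fst measurable_complex_pair. Qed.

Lemma measurable_Im : measurable_fun [set: R[i]] (@complex.Im R).
Proof. exact: measurableT_comp measurable_snd measurable_complex_pair. Qed.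

(** The measurable sets of [R[i]] are the preimages under [complex_pair] of those of [R * R], so the
    pair of coordinates decides. *)
Lemma measurable_fun_complex d (T : measurableType d) (f : T -> R[i]) :
  measurable_fun setT (fun x => complex.Re (f x)) ->
  measurable_fun setT (fun x => complex.Im (f x)) ->
  measurable_fun setT f.
Proof.
move=> mRe mIm _ _ [B mB <-]; rewrite (setTI (_ @^-1` B)).
exact: (measurable_fun_pair mRe mIm measurableT mB).
Qed.

Lemma Re_addc (x y : R[i]) : complex.Re (x + y) = complex.Re x + complex.Re y.
Proof. by case: x y => [? ?] [? ?]. Qed.
Lemma Im_addc (x y : R[i]) : complex.Im (x + y) = complex.Im x + complex.Im y.
Proof. by case: x y => [? ?] [? ?]. Qed.
Lemma Re_mulc (x y : R[i]) : complex.Re (x * y) =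
  complex.Re x * complex.Re y - complex.Im x * complex.Im y.
Proof. by case: x y => [? ?] [? ?]. Qed.
Lemma Im_mulc (x y : R[i]) : complex.Im (x * y) =
  complex.Re x * complex.Im y + complex.Im x * complex.Re y.
Proof. by case: x y => [? ?] [? ?]. Qed.

Lemma measurable_lincomb (a b : R[i]) :
  measurable_fun setT (fun yz : R[i] * R[i] => a * yz.1 + b * yz.2).
Proof.
have mRe1 := measurableT_comp measurable_Re (@measurable_fst _ _ R[i] R[i]).
have mIm1 := measurableT_comp measurable_Im (@measurable_fst _ _ R[i] R[i]).
have mRe2 := measurableT_comp measurable_Re (@measurable_snd _ _ R[i] R[i]).
have mIm2 := measurableT_comp measurable_Im (@measurable_snd _ _ R[i] R[i]).
apply: measurable_fun_complex.
  under eq_fun do rewrite Re_addc !Re_mulc.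
  by apply: measurable_funD; apply: measurable_funB; exact: measurable_funM.
under eq_fun do rewrite Im_addc !Im_mulc.
by apply: measurable_funD; apply: measurable_funD; exact: measurable_funM.
Qed.

End complex_measurability.

(** * Measures that are finite sums of weighted point masses *)

Section atomic_measures.
Context {R : realType}.

(** Atoms may repeat and the weights may have any total, so the atom list of a mixture is a mere
    concatenation. *)
Definition atomic {d} {T : measurableType d} (mu : set T -> \bar R)
    (s : seq ({nonneg R} * T)) :=
  forall A, measurable A -> mu A = (\sum_(a <- s) a.1%:num%:E * \d_(a.2) A)%E.

Lemma ge0_integral_atomic {d} {T : measurableType d}
    {mu : {measure set T -> \bar R}} {s} {f : T -> R} :
    atomic mu s -> measurable_fun setT f -> (forall x, 0 <= f x) ->
  (\int[mu]_x (f x)%:E = (\sum_(a <- s) a.1%:num * f a.2)%:E)%E.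
Proof.
move=> muE mf f0; have mEf : measurable_fun setT (EFin \o f).
  exact/measurable_EFinP.
(* The empty list is treated apart because [nth] needs a default atom, for which [a0] serves
   below. *)
case: s muE => [|a0 s'] muE.
  rewrite big_nil -[RHS](integral_measure_zero setT (EFin \o f)).
  by apply: eq_measure_integral => A mA _; rewrite muE// big_nil.
set s := a0 :: s' in muE *.
pose m_ i : {measure set T -> \bar R} :=
  mscale (nth a0 s i).1 (\d_(nth a0 s i).2).
rewrite (eq_measure_integral (msum m_ (size s))); last first.
  move=> A mA _; rewrite muE// (big_nth a0) big_mkord /msum.
  by apply: eq_bigr.
rewrite ge0_integral_measure_sum//; last by move=> x _; rewrite lee_fin.
rewrite (big_nth a0) big_mkord -sumEFin; apply: eq_bigr => i _.
rewrite ge0_integral_mscale//; last by move=> x _; rewrite lee_fin.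
by rewrite integral_dirac// diracT mul1e.
Qed.

(** The product measure integrates the [m2]-mass of the sections against [m1]. This mass is a finite
    weighted sum [f] of indicators, so [ge0_integral_atomic] applies. *)
Lemma product_atomic {d1 d2} {T1 : measurableType d1} {T2 : measurableType d2}
    {m1 : {measure set T1 -> \bar R}}
    {m2 : {sigma_finite_measure set T2 -> \bar R}} {s t} {B : set (T1 * T2)} :
    atomic m1 s -> atomic m2 t -> measurable B ->
  (m1 \x m2)%E B = (\sum_(a <- s) \sum_(b <- t)
     a.1%:num%:E * (b.1%:num%:E * \d_(a.2, b.2) B))%E.
Proof.
move=> m1E m2E mB.
pose f x : R := \sum_(b <- t) b.1%:num * \1_B (x, b.2).
have fE x : m2 (xsection B x) = (f x)%:E.
  rewrite m2E; last exact: measurable_xsection.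
  rewrite /f -sumEFin; apply: eq_bigr => b _.
  by rewrite EFinM; congr (_ * _)%E; rewrite diracE indicE mem_xsection.
have mf : measurable_fun setT f.
  apply/measurable_EFinP; rewrite [X in measurable_fun _ X](_ : _ =
    m2 \o xsection B); last by apply/funext => x /=; rewrite fE.
  exact: measurable_fun_xsection.
rewrite /product_measure1; under eq_integral do rewrite /= fE.
rewrite (ge0_integral_atomic m1E)//; last first.
  by move=> x; apply: sumr_ge0 => b _; rewrite mulr_ge0.
rewrite -sumEFin; apply: eq_bigr => a _.
rewrite /f mulr_sumr -sumEFin; apply: eq_bigr => b _.
by rewrite !EFinM diracE indicE.
Qed.

(** The positive and negative parts of [f] each integrate to a finite real sum, so their difference
    is finite and recombines term by term. *)
Lemma expectation_atomic {d} {T : measurableType d} {d'}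
    {T' : measurableType d'} {P : probability T R} {X : {RV P >-> T'}} {s}
    {f : T' -> R} :
    atomic (distribution P X) s -> measurable_fun setT f ->
  ('E_P[f \o X] = (\sum_(a <- s) a.1%:num * f a.2)%:E)%E.
Proof.
move=> PE mf; rewrite unlock integralE.
have maxE (g : T' -> R) (Y : T -> \bar R) : measurable_fun setT g ->
    (forall x, Y x = maxe (g (X x))%:E 0)%E ->
    (\int[P]_x Y x = (\sum_(a <- s) a.1%:num * Num.max (g a.2) 0)%:E)%E.
  move=> mg YE; have mg0 : measurable_fun setT (fun y => Num.max (g y) 0).
    exact: measurable_maxr.
  have g0 y : 0 <= Num.max (g y) 0 by rewrite le_max lexx orbT.
  rewrite -(ge0_integral_atomic PE mg0)// ge0_integral_distribution//.
  - by apply: eq_integral => x _; rewrite YE /= EFin_max.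
  - exact/measurable_EFinP.
rewrite (maxE f) //; last by move=> x; rewrite funeposE.
rewrite (maxE (\- f)); [|exact: measurableT_comp|]; last first.
  by move=> x; rewrite funenegE.
rewrite -EFinB -sumrB; congr _%:E; apply: eq_bigr => a _ /=.
rewrite -mulrBr; congr (_ * _).
by case: (leP (f a.2) 0); case: (leP (- f a.2) 0); lra.
Qed.

End atomic_measures.

(* In [ring_scope], [^*] would otherwise denote the generic conjugation
   [Num.conj], for which the lemmas on [conjc] do not rewrite. *)
Local Notation "x ^*" := (conjc x) : ring_scope.

(** * Complex means and variances as finite sums *)

Section complex_moments.
Context {R : realType}.
Local Open Scope complex_scope.
Implicit Types s t : seq ({nonneg R} * R[i]).

Lemma mulcJ (z : R[i]) : z * z^* = (Normc.normc z ^+ 2)%:C.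
Proof.
case: z => x y; rewrite /= sqr_sqrtr ?addr_ge0 ?sqr_ge0//.
by apply/eqP; rewrite eq_complex /=; apply/andP; split; apply/eqP; ring.
Qed.

Lemma sqr_normc (z : R[i]) :
  Normc.normc z ^+ 2 = complex.Re z ^+ 2 + complex.Im z ^+ 2.
Proof. by case: z => x y /=; rewrite sqr_sqrtr ?addr_ge0 ?sqr_ge0. Qed.

(** The integral of [f] against the measure with atoms [s]; it is complex-valued, so that moment
    computations become ring identities with conjugation. *)
Definition asum s (f : R[i] -> R[i]) : R[i] :=
  \sum_(a <- s) (a.1%:num)%:C * f a.2.

Lemma eq_asum s f g : f =1 g -> asum s f = asum s g.
Proof. by move=> fg; apply: eq_bigr => a _; rewrite fg. Qed.

Lemma asumD s f g : asum s (fun x => f x + g x) = asum s f + asum s g.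
Proof.
by rewrite /asum -big_split; apply: eq_bigr => a _ /=; rewrite mulrDr.
Qed.

Lemma asumZ s c f : asum s (fun x => c * f x) = c * asum s f.
Proof. by rewrite /asum mulr_sumr; apply: eq_bigr => a _; rewrite mulrCA. Qed.

Lemma asum_cst s c : asum s (fun=> 1) = 1 -> asum s (fun=> c) = c.
Proof.
move=> s1; rewrite -[RHS]mulr1 -s1 -asumZ.
by apply: eq_asum => x; rewrite mulr1.
Qed.

Lemma conj_asum s f : (asum s f)^* = asum s (fun x => (f x)^*).
Proof.
rewrite /asum rmorph_sum; apply: eq_bigr => a _.
by rewrite rmorphM /= oppr0.
Qed.

(** The atoms of the law of [a * x + b * y] for independent [x] and [y] with atoms [s] and [t],
    scaled by the weight [w] of a case. *)
Definition comb (w : {nonneg R}) (a b : R[i]) s t :=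
  [seq ((w%:num * x.1%:num * y.1%:num)%:nng, a * x.2 + b * y.2)
     | x <- s, y <- t].

Lemma asum_cat s t f : asum (s ++ t) f = asum s f + asum t f.
Proof. by rewrite /asum big_cat. Qed.

Lemma asum_comb w a b s t f : asum (comb w a b s t) f =
  (w%:num)%:C * asum s (fun x => asum t (fun y => f (a * x + b * y))).
Proof.
rewrite /asum big_allpairs_dep mulr_sumr; apply: eq_bigr => x _.
rewrite mulrA mulr_sumr; apply: eq_bigr => y _ /=.
by rewrite !rmorphM !mulrA.
Qed.

Definition amean s := asum s id.
Definition asecond s := asum s (fun z => z * z^*).
Definition avar s := asecond s - amean s * (amean s)^*.

Lemma amean_comb a b {s t} : asum s (fun=> 1) = 1 -> asum t (fun=> 1) = 1 ->
  asum s (fun x => asum t (fun y => a * x + b * y)) = a * amean s + b * amean t.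
Proof.
move=> s1 t1; under eq_asum do rewrite asumD asum_cst// asumZ.
by rewrite asumD asumZ asum_cst.
Qed.

(** Coefficients of modulus 1 preserve variances, and independence turns the cross terms into
    products of means. *)
Lemma asecond_comb {a b s t} : asum s (fun=> 1) = 1 -> asum t (fun=> 1) = 1 ->
    a * a^* = 1 -> b * b^* = 1 ->
  asum s (fun x => asum t
    (fun y => (a * x + b * y) * (a * x + b * y)^*)) =
  avar s + avar t +
  (a * amean s + b * amean t) * (a * amean s + b * amean t)^*.
Proof.
move=> s1 t1 aa bb.
(* Average over [y] with [x] fixed: the cross terms become linear in [x] and its conjugate, ready
   for the average over [x]. *)
have xE x : asum t (fun y => (a * x + b * y) * (a * x + b * y)^*) =
    x * x^* + ((a * b^* * (amean t)^*) * x + (a^* * b * amean t) * x^*)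
    + asecond t.
  rewrite (@eq_asum _ _ (fun y => x * x^* + ((a * b^* * x) * y^* +
    (a^* * b * x^*) * y) + y * y^*)); last first.
    move=> y; rewrite rmorphD !rmorphM /=.
    transitivity (a * a^* * (x * x^*) + (a * b^* * x * y^* +
      a^* * b * x^* * y) + b * b^* * (y * y^*)); first by ring.
    by rewrite aa bb !mul1r.
  rewrite !asumD !asumZ asum_cst// -conj_asum -/(amean t) -/(asecond t).
  by ring.
under eq_asum do rewrite xE.
rewrite !asumD !asumZ asum_cst// -conj_asum -/(amean s) -/(asecond s).
rewrite /avar rmorphD !rmorphM /=.
transitivity (asecond s - amean s * (amean s)^* + (asecond t - amean t * (amean t)^*)
 + (a * a^*) * amean s * (amean s)^* + (b * b^*) * amean t * (amean t)^* +
 (a * b^* * (amean t)^* * amean s + a^* * b * amean t * (amean s)^*)).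
  by rewrite aa bb; ring.
by ring.
Qed.

Lemma cexpectation_atomic {d} {T : measurableType d} {P : probability T R}
    {X : {RV P >-> R[i]}} {s} :
  atomic (distribution P X) s -> cexpectation P X = amean s.
Proof.
move=> Xs; rewrite /cexpectation.
rewrite (expectation_atomic Xs measurable_Re).
rewrite (expectation_atomic Xs measurable_Im).
rewrite /amean /asum /=; elim: (s) => [|a s' IH]; first by rewrite !big_nil.
rewrite !big_cons -IH; case: a => [w [x y]] /=.
by apply/eqP; rewrite eq_complex /= !mul0r subr0 addr0 !eqxx.
Qed.

Lemma cvariance_atomic {d} {T : measurableType d} {P : probability T R}
    {X : {RV P >-> R[i]}} {s} :
  atomic (distribution P X) s -> (cvariance P X)%:C = avar s.
Proof.
move=> Xs; rewrite /cvariance (cexpectation_atomic Xs) rmorphB /= -mulcJ.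
congr (_ - _).
rewrite (expectation_atomic (f := fun z => Normc.normc z ^+ 2) Xs).
  rewrite /= rmorph_sum; apply: eq_bigr => a _.
  by rewrite rmorphM mulcJ.
under eq_fun do rewrite sqr_normc.
by apply: measurable_funD; apply: measurable_funX;
  [exact: measurable_Re|exact: measurable_Im].
Qed.

(** The expectation of the constant 1 is computed in two ways. *)
Lemma asum_mass {d} {T : measurableType d} {P : probability T R}
    {X : {RV P >-> R[i]}} {s} :
  atomic (distribution P X) s -> asum s (fun=> 1) = 1.
Proof.
move=> Xs; have := expectation_atomic (f := fun=> 1) Xs (measurable_cst _).
rewrite (expectation_cst P 1).
move=> [/(congr1 (real_complex R))]; rewrite rmorph_sum rmorph1 => h; rewrite [RHS]h.
by apply: eq_bigr => a _; rewrite rmorphM rmorph1.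
Qed.

(** By [product_atomic], each image of the product measure is a sum over pairs of atoms, which is
    what [comb] lists; adding the two cases concatenates the lists. *)
Lemma atomic_mixture {w0 w1 : {nonneg R}} {a0 b0 a1 b1 : R[i]}
    {mu mu1 mu2 : probability R[i] R} {s t} :
    atomic mu1 s -> atomic mu2 t ->
    (forall A : set R[i], measurable A ->
      mu A = (w0%:num%:E * (mu1 \x mu2)
                [set yz : R[i] * R[i] | A (a0 * yz.1 + b0 * yz.2)%R] +
              w1%:num%:E * (mu1 \x mu2)
                [set yz : R[i] * R[i] | A (a1 * yz.1 + b1 * yz.2)%R])%E) ->
  atomic mu (comb w0 a0 b0 s t ++ comb w1 a1 b1 s t).
Proof.
move=> mu1s mu2t muE A mA; rewrite muE// big_cat.
have combE w a b : (w%:num%:E * (mu1 \x mu2)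
      [set yz : R[i] * R[i] | A (a * yz.1 + b * yz.2)%R])%E =
    (\sum_(x <- comb w a b s t) x.1%:num%:E * \d_(x.2) A)%E.
  rewrite (product_atomic mu1s mu2t); last first.
    by rewrite -[X in measurable X]setTI; exact: measurable_lincomb.
  rewrite big_allpairs_dep ge0_sume_distrr; last first.
    by move=> x _; apply: sume_ge0 => y _; rewrite !mule_ge0// lee_fin.
  apply: eq_bigr => x _; rewrite ge0_sume_distrr; last first.
    by move=> y _; rewrite !mule_ge0// lee_fin.
  apply: eq_bigr => y _ /=; rewrite !EFinM !muleA; congr (_ * _)%E.
by rewrite /= -!combE.
Qed.

End complex_moments.

(** * Recursions for the mean and variance of the inflation variables *)

Section inflation_moments.
Context {R : realType}.
Local Open Scope complex_scope.

Lemma phaseD (x y : R) : phase (x + y) = phase x * phase y.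
Proof.
apply/eqP; rewrite eq_complex /= mulrDr cosD sinD.
by apply/andP; split; apply/eqP; ring.
Qed.

Lemma phase_mulcJ (x : R) : phase x * (phase x)^* = 1.
Proof.
rewrite mulcJ sqr_normc /= sqrrN cos2Dsin2; exact: rmorph1.
Qed.

Lemma normc_phase (x : R) : Normc.normc (phase x) = 1.
Proof. by rewrite /= sqrrN cos2Dsin2 sqrtr1. Qed.

Lemma phaseLS (k : R) n : phaseL k n.+2 = phaseL k n.+1 * phaseL k n.
Proof. by rewrite /phaseL -phaseD -mulrDr. Qed.

(** The law of total variance for two cases with means [A], [B] and common variance [v]: the last
    term is the variance between the cases. *)
Lemma avar_mixture (p0 p1 : R) (A B v : R[i]) : p0 + p1 = 1 ->
  p0%:C * (v + A * A^*) + p1%:C * (v + B * B^*) -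
    (p0%:C * A + p1%:C * B) * (p0%:C * A + p1%:C * B)^* =
  v + (p0 * p1)%:C * ((B - A) * (B - A)^*).
Proof.
move=> p01; have -> : p1 = 1 - p0 by rewrite -p01; ring.
have -> : (B - A)^* = B^* - A^* by exact: rmorphB.
have -> : (p0%:C * A + (1 - p0)%:C * B)^* = p0%:C * A^* + (1 - p0)%:C * B^*.
  by rewrite -{2}(conjc_real p0) -{2}(conjc_real (1 - p0)) -!(rmorphM conjc) -rmorphD.
by rewrite rmorphM rmorphB rmorph1; ring.
Qed.

Context {p0 p1 k : R} (p0_gt0 : 0 < p0) (p1_gt0 : 0 < p1) (p01 : p0 + p1 = 1).
Context {d : nat -> measure_display} {T : forall n, measurableType (d n)}.
Context {P : forall n, probability (T n) R} {X : forall n, {RV P n >-> R[i]}}.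
Hypothesis X_laws : inflation_laws p0 p1 k (fun n => distribution (P n) (X n)).

Let w0 : {nonneg R} := NngNum (ltW p0_gt0).
Let w1 : {nonneg R} := NngNum (ltW p1_gt0).
Let E n := cexpectation (P n) (X n).
Let V n := cvariance (P n) (X n).

Let step n s t :=
  comb w0 (phaseL k n) 1 s t ++ comb w1 1 (phaseL k n.+1) s t.

Let atomic_step n s t :
  atomic (distribution (P n.+1) (X n.+1)) s ->
  atomic (distribution (P n) (X n)) t ->
  atomic (distribution (P n.+2) (X n.+2)) (step n s t).
Proof.
move=> Xs Xt; have [_ _ XS] := X_laws.
apply: (atomic_mixture Xs Xt) => A mA; rewrite XS//.
under [X in (_ = _ * _ X + _)%E]eq_fun do rewrite mul1r addrC.
by under [X in (_ = _ + _ * _ X)%E]eq_fun do rewrite mul1r.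
Qed.

Let atomic_dirac n z :
  (forall A : set R[i], measurable A -> distribution (P n) (X n) A = \d_z A) ->
  atomic (distribution (P n) (X n)) [:: (1%:nng, z)].
Proof. by move=> XE A mA; rewrite XE// big_seq1 mul1e. Qed.

Lemma inflation_atomic n : exists s, atomic (distribution (P n) (X n)) s.
Proof.
(* The recursion reaches two indices back, so the induction carries two consecutive laws. *)
suff [] : (exists s, atomic (distribution (P n) (X n)) s) /\
  (exists s, atomic (distribution (P n.+1) (X n.+1)) s) by [].
case: X_laws => X0 X1 _.
elim: n => [|n [[t Xt] [s Xs]]]; split.
- by eexists; exact: atomic_dirac X0.
- by eexists; exact: atomic_dirac X1.
- by exists s.
- by eexists; exact: atomic_step Xs Xt.
Qed.

Let moments_dirac n z :
  (forall A : set R[i], measurable A -> distribution (P n) (X n) A = \d_z A) ->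
  E n = z /\ V n = 0.
Proof.
move=> /atomic_dirac Xn; have En : E n = z.
  by rewrite /E (cexpectation_atomic Xn) /amean /asum big_seq1 mul1r.
split=> //; apply: (@complexI R); rewrite /V (cvariance_atomic Xn) rmorph0.
by rewrite /avar -(cexpectation_atomic Xn) -/(E n) En /asecond /asum big_seq1
  mul1r subrr.
Qed.

Lemma inflation_moments0 : E 0 = phase k /\ V 0 = 0.
Proof. by apply: moments_dirac; case: X_laws. Qed.

Lemma inflation_moments1 : E 1 = phase (k * lambda1) /\ V 1 = 0.
Proof. by apply: moments_dirac; case: X_laws. Qed.

Lemma inflation_mean n : E n.+2 =
  (p1%:C + p0%:C * phaseL k n) * E n.+1 + (p0%:C + p1%:C * phaseL k n.+1) * E n.
Proof.
have [s Xs] := inflation_atomic n.+1; have [t Xt] := inflation_atomic n.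
rewrite /E (cexpectation_atomic (atomic_step _ _ _ Xs Xt)).
rewrite (cexpectation_atomic Xs) (cexpectation_atomic Xt).
rewrite /amean /step asum_cat !asum_comb -!/(amean _).
rewrite !amean_comb ?(asum_mass Xs) ?(asum_mass Xt)//=.
by rewrite /amean; ring.
Qed.

(** Phases have modulus 1, so both cases have variance [V n.+1 + V n]. The difference of their means
    is the quantity under the norm in [Psi], and the factor 2 offsets the [2^-1] there. *)
Lemma inflation_variance n :
  V n.+2 = V n.+1 + V n + 2 * p0 * p1 * Psi k E n.+2.
Proof.
have [s Xs] := inflation_atomic n.+1; have [t Xt] := inflation_atomic n.
suff : avar (step n s t) = avar s + avar t + (2 * p0 * p1 * Psi k E n.+2)%:C.
  rewrite -(cvariance_atomic Xs) -(cvariance_atomic Xt).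
  rewrite -(cvariance_atomic (atomic_step _ _ _ Xs Xt)) -!rmorphD.
  exact: complexI.
rewrite /avar [amean (step n s t)]/amean /asecond /step !asum_cat !asum_comb.
rewrite !amean_comb ?(asum_mass Xs) ?(asum_mass Xt)//=.
have one : (1 : R[i]) * 1^* = 1 by rewrite conjc1 mul1r.
rewrite !asecond_comb ?(asum_mass Xs) ?(asum_mass Xt) ?phase_mulcJ ?one//=.
rewrite !mul1r.
rewrite (avar_mixture _ _ _ _ _ p01); congr (_ + _).
rewrite mulcJ -rmorphM; congr (_%:C).
rewrite /Psi !subSS !subn0.
rewrite /E (cexpectation_atomic Xs) (cexpectation_atomic Xt).
rewrite [X in Normc.normc X ^+ 2](_ : _ = 
  (1 - phaseL k n) * amean s - (1 - phaseL k n.+1) * amean t); last by ring.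
by field.
Qed.

End inflation_moments.

(** * The golden ratio and its powers *)

Section inflation_factor.
Context {R : realType}.
Local Notation lambda := (@lambda1 R).

Lemma lambda1_sqr : lambda ^+ 2 = lambda + 1.
Proof.
have h : Num.sqrt 5 ^+ 2 = 5 :> R by rewrite sqr_sqrtr.
by rewrite /lambda1; field: h.
Qed.

(** Eliminates the square root, so that later [field] calls need only the quadratic relation of
    [lambda]. *)
Lemma sqrt5E : Num.sqrt 5 = 2 * lambda - 1.
Proof. by rewrite /lambda1; field. Qed.

Lemma lambda1_gt1 : 1 < lambda.
Proof.
rewrite /lambda1; have : 1 < Num.sqrt 5 :> R; last by lra.
by rewrite -[ltLHS]sqrtr1 ltr_sqrt //; lra.
Qed.

Lemma lambda1_gt0 : 0 < lambda.
Proof. by have := lambda1_gt1; lra. Qed.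

Lemma LseqE n : Lseq R n = lambda ^+ n.
Proof.
suff [] : Lseq R n = lambda ^+ n /\ Lseq R n.+1 = lambda ^+ n.+1 by [].
elim: n => [|n [IH0 IH1]]; first by rewrite expr1.
by split=> //=; rewrite -/(Lseq R n.+1) IH0 IH1 !exprS mulrA -expr2 lambda1_sqr; ring.
Qed.

End inflation_factor.

(** * A Fibonacci recursion with bounded forcing, for abstract sequences *)

Section variance_recursion.
Context {R : realType} {V psi : nat -> R} {q : R}.
Local Notation lambda := (@lambda1 R).
Hypotheses (q_ge0 : 0 <= q) (V0 : V 0%N = 0) (V1 : V 1%N = 0).
Hypothesis psi_bound : forall n, 0 <= psi n.+2 <= 8.
Hypothesis VS : forall n, V n.+2 = V n.+1 + V n + q * psi n.+2.

Let S N := \sum_(2 <= i < N) lambda ^- i * psi i.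
Let c := q * lambda / Num.sqrt 5.

Lemma variance_recursion_ge0 n : 0 <= V n.
Proof.
suff [] : 0 <= V n /\ 0 <= V n.+1 by [].
elim: n => [|n [IH0 IH1]]; first by rewrite V0 V1.
split=> //; rewrite VS; have /andP[? ?] := psi_bound n.
by rewrite !addr_ge0 // mulr_ge0.
Qed.

(* [V n.+1 + lambda^-1 V n] and [V n.+1 - lambda V n] are the two eigenmodes of
   the Fibonacci recursion, for the eigenvalues [lambda] and [- lambda^-1]. *)
Let growing_mode n : V n.+1 + lambda^-1 * V n = q * lambda ^+ n.+1 * S n.+2.
Proof.
have l0 := @lambda1_gt0 R; have l2 := @lambda1_sqr R.
elim: n => [|n IH]; first by rewrite V0 V1 /S big_geq// !mulr0 addr0.
rewrite /S big_nat_recr//= -/(S n.+2) mulrDr.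
transitivity (lambda * (q * lambda ^+ n.+1 * S n.+2) + q * psi n.+2).
  rewrite -IH VS; field: l2; lra.
rewrite !exprS; have := lt0r_neq0 (exprn_gt0 n l0) => ln.
by field; rewrite ln lt0r_neq0.
Qed.

Let decaying_mode n : `|V n.+1 - lambda * V n| <= 8 * q * lambda ^+ 2.
Proof.
have l1 := @lambda1_gt1 R; have l2 := @lambda1_sqr R.
have l0 := @lambda1_gt0 R.
elim: n => [|n IH].
  by rewrite V0 V1 mulr0 subrr normr0 !mulr_ge0// ltW.
have -> : V n.+2 - lambda * V n.+1 =
    - (lambda^-1 * (V n.+1 - lambda * V n)) + q * psi n.+2.
  rewrite VS; field: l2; lra.
apply: le_trans (ler_normD _ _) _; rewrite normrN !normrM.
rewrite (ger0_norm q_ge0) (gtr0_norm (x := lambda^-1)) ?invr_gt0//.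
have /andP[psi0 psi8] := psi_bound n; rewrite (ger0_norm psi0).
(* The bound [M = 8 * q * lambda ^+ 2] is the fixed point of [M = lambda^-1 * M + 8 * q], because
   [1 - lambda^-1 = lambda ^- 2]. *)
apply: le_trans (lerD (ler_wpM2l _ IH) (ler_wpM2l q_ge0 psi8)) _.
  by rewrite invr_ge0 ltW.
have -> : lambda^-1 * (8 * q * lambda ^+ 2) = 8 * q * lambda.
  by field; rewrite lt0r_neq0.
by rewrite l2; lra.
Qed.

(** As [lambda ^+ 2 + 1 = Num.sqrt 5 * lambda], [V n.+1] is [lambda / Num.sqrt 5] times the growing
    mode plus the decaying mode over [Num.sqrt 5 * lambda]. The first part gives exactly the partial
    sum, the second the error. The upper index of [S] is exclusive, so [S n.+1] stops at index
    [n]. *)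
Let mode_bound n :
  `|V n / lambda ^+ n - c * S n.+1| <= 8 * c * lambda ^- n.
Proof.
have l1 := @lambda1_gt1 R; have l2 := @lambda1_sqr R.
have l0 := @lambda1_gt0 R.
have c0 : 0 <= c by rewrite /c !mulr_ge0 ?invr_ge0 ?sqrtr_ge0// ltW.
case: n => [|n].
  by rewrite V0 mul0r /S big_geq// mulr0 subrr normr0 !mulr_ge0// invr_ge0.
have s5 : 0 < 2 * lambda - 1 by lra.
have ln := exprn_gt0 n.+1 l0.
have -> : V n.+1 / lambda ^+ n.+1 - c * S n.+2 =
    (V n.+1 - lambda * V n) / (Num.sqrt 5 * lambda) * lambda ^- n.+1.
  have -> : c * S n.+2 =
      lambda / Num.sqrt 5 * (q * lambda ^+ n.+1 * S n.+2) / lambda ^+ n.+1.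
    by rewrite /c sqrt5E; field; rewrite !lt0r_neq0.
  rewrite -growing_mode sqrt5E; field: l2; rewrite !lt0r_neq0//.
rewrite normrM (gtr0_norm (x := lambda ^- n.+1)) ?invr_gt0//.
rewrite ler_pM2r ?invr_gt0// normrM normfV (gtr0_norm (x := _ * lambda)); last first.
  by rewrite sqrt5E mulr_gt0.
rewrite ler_pdivrMr ?sqrt5E ?mulr_gt0//.
apply: le_trans (decaying_mode n) _; rewrite /c sqrt5E.
rewrite [leRHS](_ : _ = 8 * q * lambda ^+ 2)//.
by field; rewrite lt0r_neq0.
Qed.

Let S_nondecreasing : nondecreasing_seq S.
Proof.
apply/nondecreasing_seqP => -[|[|n]]; rewrite /S; [by rewrite !big_geq..|].
rewrite [leRHS]big_nat_recr//= lerDl; have /andP[? _] := psi_bound n.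
by rewrite mulr_ge0// invr_ge0 exprn_ge0// ltW// lambda1_gt0.
Qed.

(** The correction is the full geometric tail of [8 * lambda ^- i] from [i = n] on, since
    [1 / (1 - lambda^-1) = lambda ^+ 2]. Adding it to [S n] therefore gives a nonincreasing
    sequence. *)
Let S_upper m n : (n <= m)%N -> S m <= S n + 8 * lambda ^+ 2 * lambda ^- n.
Proof.
have l1 := @lambda1_gt1 R; have l2 := @lambda1_sqr R.
have l0 := @lambda1_gt0 R.
have Q_nonincreasing :
    nonincreasing_seq (fun n => S n + 8 * lambda ^+ 2 * lambda ^- n).
  apply/nonincreasing_seqP => i.
  have -> : S i.+1 = S i + (if (2 <= i)%N then lambda ^- i * psi i else 0).
    case: i => [|[|i]]; rewrite /S; [by rewrite !big_geq// addr0..|].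
    by rewrite big_nat_recr.
  rewrite -addrA lerD2l.
  have li := exprn_gt0 i l0.
  have -> : 8 * lambda ^+ 2 * lambda ^- i.+1 = 8 * lambda * lambda ^- i.
    by rewrite (exprS _ i); field; rewrite !lt0r_neq0.
  have vi : 0 < lambda ^- i by rewrite invr_gt0.
  (* The increment is 0 for [i < 2] and at most [8 * lambda ^- i] otherwise;
     [1 + lambda = lambda ^+ 2] then closes the comparison. *)
  apply: (@le_trans _ _ (8 * lambda ^- i + 8 * lambda * lambda ^- i)).
    rewrite lerD2r; case: i li vi => [|[|i]] li vi /=; [lra|lra|].
    by have /andP[_ ?] := psi_bound i; rewrite mulrC ler_pM2r.
  by rewrite l2; lra.
move=> nm; apply: le_trans (Q_nonincreasing _ _ nm).
by rewrite lerDl !mulr_ge0// ?invr_ge0 ?exprn_ge0// ltW.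
Qed.

Lemma weighted_sum_cvg : cvgn S.
Proof.
apply: nondecreasing_is_cvgn S_nondecreasing _.
by exists (S 0%N + 8 * lambda ^+ 2 * lambda ^- 0) => _ [n _ <-]; exact: S_upper.
Qed.

Lemma weighted_sum_lim n :
  S n <= limn S <= S n + 8 * lambda ^+ 2 * lambda ^- n.
Proof.
rewrite nondecreasing_cvgn_le//=; last exact: weighted_sum_cvg.
apply: limr_le; first exact: weighted_sum_cvg.
by exists n => // m; exact: S_upper.
Qed.

(** The decaying mode contributes [8 * c], the tail of the series beyond [S n.+1] contributes
    [8 * c * lambda]. The constant depends on [q] alone, whence uniformity in [k] later. *)
Lemma variance_rate n :
  `|V n / lambda ^+ n - c * limn S| <= 8 * c * (1 + lambda) * lambda ^- n.
Proof.
have l0 := @lambda1_gt0 R.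
have c0 : 0 <= c by rewrite /c !mulr_ge0 ?invr_ge0 ?sqrtr_ge0// ltW.
have -> : V n / lambda ^+ n - c * limn S =
  V n / lambda ^+ n - c * S n.+1 + c * (S n.+1 - limn S) by ring.
apply: le_trans (ler_normD _ _) _.
have -> : 8 * c * (1 + lambda) * lambda ^- n =
  8 * c * lambda ^- n + c * (8 * lambda * lambda ^- n) by ring.
apply: lerD; [exact: mode_bound|rewrite normrM (ger0_norm c0)].
have /andP[lo hi] := weighted_sum_lim n.+1.
rewrite [leRHS](_ : _ = c * (8 * lambda ^+ 2 * lambda ^- n.+1)); last first.
  have ln := exprn_gt0 n l0.
  by rewrite (exprS _ n); field; rewrite !lt0r_neq0.
by rewrite ler_wpM2l// distrC ger0_norm; lra.
Qed.

End variance_recursion.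

(** * A bound on [Psi] uniform in the index and in [k] *)

Section psi.
Context {R : realType}.
Local Open Scope complex_scope.
Local Notation normc := (@Normc.normc R).

Lemma normc_ge0 (z : R[i]) : 0 <= normc z.
Proof. by case: z => x y; exact: sqrtr_ge0. Qed.

Lemma normc_real (x : R) : normc x%:C = `|x|.
Proof. by rewrite /= expr0n addr0 sqrtr_sqr. Qed.

Lemma normc_convex (p0 p1 : R) (z : R[i]) : 0 <= p0 -> 0 <= p1 ->
  p0 + p1 = 1 -> normc z = 1 -> normc (p0%:C + p1%:C * z) <= 1.
Proof.
move=> p0_ge0 p1_ge0 p01 z1; apply: le_trans (le_normcD _ _) _.
by rewrite Normc.normcM z1 !normc_real !ger0_norm// mulr1 p01.
Qed.

Lemma normc_one_sub_phaseL_mul (k : R) n z : normc z = 1 ->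
  normc ((1 - phaseL k n) * z) <= 2.
Proof.
move=> z1; rewrite Normc.normcM z1 mulr1; apply: le_trans (le_normcD _ _) _.
by rewrite normcN normc_phase Normc.normc1.
Qed.

(** This is [D_(n+2)] of the overview; the shift avoids truncated subtraction. *)
Definition psi_root (k : R) (E : nat -> R[i]) n : R[i] :=
  (1 - phaseL k n) * E n.+1 - (1 - phaseL k n.+1) * E n.

Lemma PsiE k E n : Psi k E n.+2 = 2^-1 * normc (psi_root k E n) ^+ 2.
Proof. by rewrite /Psi !subSS !subn0. Qed.

Context {p0 p1 k : R} {E : nat -> R[i]}.
Hypotheses (p0_ge0 : 0 <= p0) (p1_ge0 : 0 <= p1) (p01 : p0 + p1 = 1).
Hypotheses (E0 : E 0 = phase k) (E1 : E 1 = phase (k * lambda1)).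
Hypothesis ES : forall n, E n.+2 =
  (p1%:C + p0%:C * phaseL k n) * E n.+1 + (p0%:C + p1%:C * phaseL k n.+1) * E n.

(* [phaseL] turns the additive recursion of [Lseq] into
   [phaseL k n.+2 = phaseL k n.+1 * phaseL k n], which makes this exact. *)
Lemma psi_rootS n : psi_root k E n.+1 =
  - ((p0%:C + p1%:C * phaseL k n.+1) * psi_root k E n).
Proof.
rewrite /psi_root phaseLS ES.
have -> : p1 = 1 - p0 by rewrite -p01 addrAC subrr add0r.
by rewrite rmorphB rmorph1; ring.
Qed.

(** Initially there are two terms of modulus at most 2. By [psi_rootS], each step multiplies, up to
    sign, by a convex combination of 1 and a phase, whose modulus is at most 1. *)
Lemma normc_psi_root n : normc (psi_root k E n) <= 4.
Proof.
elim: n => [|n IH]; last first.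
  rewrite psi_rootS normcN Normc.normcM; apply: le_trans IH.
  by rewrite ler_piMl ?normc_ge0 ?normc_convex ?normc_phase.
apply: le_trans (le_normcD _ _) _; rewrite normcN E0 E1.
rewrite [leRHS](_ : 4 = 2 + 2); last by ring.
by rewrite lerD ?normc_one_sub_phaseL_mul ?normc_phase.
Qed.

Lemma Psi_bound n : 0 <= Psi k E n.+2 <= 8.
Proof.
rewrite PsiE; have := normc_ge0 (psi_root k E n); have := normc_psi_root n.
by move: (normc _) => x; nra.
Qed.

End psi.

(** * Continuity in [k] of the means, of [Psi] and of the partial sums *)

Section continuity.
Context {R : realType}.
Local Open Scope complex_scope.

(** Stated by coordinates, so that only limits of real-valued functions occur. *)
Definition ccontinuous (f : R -> R[i]) :=
  continuous (fun k => complex.Re (f k)) /\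
  continuous (fun k => complex.Im (f k)).

Lemma ccontinuous_cst c : ccontinuous (fun=> c).
Proof. by split=> x; exact: cvg_cst. Qed.

Lemma ccontinuousD f g : ccontinuous f -> ccontinuous g ->
  ccontinuous (fun k => f k + g k).
Proof.
move=> [fr fi] [gr gi]; split.
  by under eq_fun do rewrite Re_addc; move=> x; apply: cvgD; [exact: fr|exact: gr].
by under eq_fun do rewrite Im_addc; move=> x; apply: cvgD; [exact: fi|exact: gi].
Qed.

Lemma ccontinuousM f g : ccontinuous f -> ccontinuous g ->
  ccontinuous (fun k => f k * g k).
Proof.
move=> [fr fi] [gr gi]; split.
  under eq_fun do rewrite Re_mulc; move=> x; apply: cvgB; apply: cvgM;
  by [exact: fr|exact: gr|exact: fi|exact: gi].
under eq_fun do rewrite Im_mulc; move=> x; apply: cvgD; apply: cvgM;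
by [exact: fr|exact: gr|exact: fi|exact: gi].
Qed.

Lemma ccontinuousB f g : ccontinuous f -> ccontinuous g ->
  ccontinuous (fun k => f k - g k).
Proof.
move=> cf cg; rewrite (_ : (fun _ => _) = fun k => f k + (-1) * g k).
  by apply: ccontinuousD => //; apply: ccontinuousM => //; exact: ccontinuous_cst.
by apply/funext => k; rewrite mulN1r.
Qed.

Lemma ccontinuous_phase (c : R) : ccontinuous (fun k => phase (k * c)).
Proof.
have lin : continuous (fun k : R => 2 * pi * (k * c)).
  by move=> x; apply: cvgM; [exact: cvg_cst|apply: cvgM; [exact: cvg_id|exact: cvg_cst]].
split=> x /=.
  by apply: continuous_comp; [exact: lin|exact: continuous_cos].
by apply: cvgN; apply: continuous_comp; [exact: lin|exact: continuous_sin].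
Qed.

Lemma continuous_Psi (E : nat -> R -> R[i]) n :
  (forall m, ccontinuous (E m)) ->
  continuous (fun k => Psi k (E ^~ k) n).
Proof.
move=> cE.
have cp m : ccontinuous (fun k => 1 - phaseL k m).
  by apply: ccontinuousB; [exact: ccontinuous_cst|exact: ccontinuous_phase].
rewrite /Psi; under eq_fun do rewrite sqr_normc.
set f := fun k => (1 - phaseL k (n - 2)) * E (n - 1)%N k -
  (1 - phaseL k (n - 1)) * E (n - 2)%N k.
have [fr fi] : ccontinuous f.
  by apply: ccontinuousB; apply: ccontinuousM.
move=> x; apply: cvgM; first exact: cvg_cst.
by apply: cvgD; apply: cvgM; [exact: fr|exact: fr|exact: fi|exact: fi].
Qed.

Lemma continuous_partial_sum (F : nat -> R -> R) (c : nat -> R) m N :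
  (forall n, continuous (F n)) ->
  continuous (fun k => \sum_(m <= i < N) c i * F i k).
Proof.
move=> cF; elim: (index_iota m N) => [|i s IH].
  by under eq_fun do rewrite big_nil; move=> x; exact: cvg_cst.
under eq_fun do rewrite big_cons; move=> x.
by apply: cvgD; [apply: cvgM; [exact: cvg_cst|exact: cF]|exact: IH].
Qed.

Lemma ccontinuous_mean (p0 p1 : R) (E : nat -> R -> R[i]) :
  (forall k, E 0 k = phase k) -> (forall k, E 1 k = phase (k * lambda1)) ->
  (forall n k, E n.+2 k = (p1%:C + p0%:C * phaseL k n) * E n.+1 k +
     (p0%:C + p1%:C * phaseL k n.+1) * E n k) ->
  forall n, ccontinuous (E n).
Proof.
move=> E0 E1 ES n.
suff [] : ccontinuous (E n) /\ ccontinuous (E n.+1) by [].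
elim: n => [|n [IH0 IH1]]; split=> //.
- rewrite (_ : E 0 = fun k => phase (k * 1)); first exact: ccontinuous_phase.
  by apply/funext => k; rewrite E0 mulr1.
- rewrite (_ : E 1 = fun k => phase (k * lambda1)); first exact: ccontinuous_phase.
  exact/funext.
- rewrite (_ : E n.+2 = fun k => (p1%:C + p0%:C * phaseL k n) * E n.+1 k +
     (p0%:C + p1%:C * phaseL k n.+1) * E n k); last exact/funext.
  have cp a b m : ccontinuous (fun k => a%:C + b%:C * phaseL k m).
    apply: ccontinuousD; first exact: ccontinuous_cst.
    by apply: ccontinuousM; [exact: ccontinuous_cst|exact: ccontinuous_phase].
  by apply: ccontinuousD; exact: ccontinuousM.
Qed.

End continuity.

(** * Uniform convergence at a geometric rate, applied to the variances *)

Lemma geometric_uniform_cvg {R : realType} {f_ : nat -> R -> R} {f : R -> R}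
    {C r : R} : `|r| < 1 ->
  (forall n k, `|f_ n k - f k| <= C * r ^+ n) -> {uniform, f_ @ \oo --> f}.
Proof.
move=> r1 fr A /uniform_nbhs[B [entB BA]].
have [e e0 eB] : exists2 e : R, 0 < e &
    forall x y : R, `|x - y| < e -> B (x, y).
  move: entB; rewrite -entourage_ballE => -[e e0 eB].
  by exists e => // x y xy; apply: eB.
have /cvgrPdist_lt/(_ _ e0) := cvg_geometric C r1.
apply: filterS => n /=; rewrite sub0r normrN => Cn.
apply: BA => k _; apply: eB; rewrite distrC; apply: le_lt_trans (fr n k) _.
exact: le_lt_trans (ler_norm _) Cn.
Qed.

Theorem proposition6p3 (R : realType) (p0 p1 : R)
  (p0_gt0 : 0 < p0) (p1_gt0 : 0 < p1) (p01 : p0 + p1 = 1)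
  (d : nat -> R -> measure_display)
  (T : forall (n : nat) (k : R), measurableType (d n k))
  (P : forall (n : nat) (k : R), probability (T n k) R)
  (X : forall (n : nat) (k : R), {RV P n k >-> R[i]})
  (X_laws : forall k : R,
     inflation_laws p0 p1 k (fun n : nat => distribution (P n k) (X n k))) :
  let phi_ (n : nat) (k : R) : R := cvariance (P n k) (X n k) / Lseq R n in
  let Psi_ (n : nat) (k : R) : R :=
    Psi k (fun m : nat => cexpectation (P m k) (X m k)) n in
  let partial_sum (k : R) (N : nat) : R :=
    \sum_(2 <= i < N) lambda1 ^- i * Psi_ i k in
  let phi (k : R) : R :=
    2 * p0 * p1 * lambda1 / Num.sqrt 5 * limn (partial_sum k) in
  (forall k : R, cvgn (partial_sum k)) /\
  (forall (n : nat) (k : R), 0 <= phi_ n k) /\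
  (forall k : R, 0 <= phi k) /\
  continuous phi /\
  {uniform, phi_ @ \oo --> phi}.
Proof.
move=> phi_ Psi_ partial_sum phi.
pose E n k := cexpectation (P n k) (X n k).
pose V n k := cvariance (P n k) (X n k).
pose q := 2 * p0 * p1; pose c := q * lambda1 / Num.sqrt 5.
have l0 := @lambda1_gt0 R; have l1 := @lambda1_gt1 R.
have q0 : 0 <= q by rewrite /q !mulr_ge0// ltW.
have c0 : 0 <= c by rewrite /c !mulr_ge0 ?invr_ge0 ?sqrtr_ge0// ltW.
have E0 k : E 0 k = phase k by have [] := inflation_moments0 (X_laws k).
have V0 k : V 0 k = 0 by have [] := inflation_moments0 (X_laws k).
have E1 k : E 1 k = phase (k * lambda1).
  by have [] := inflation_moments1 (X_laws k).
have V1 k : V 1 k = 0 by have [] := inflation_moments1 (X_laws k).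
have ES n k := inflation_mean p0_gt0 p1_gt0 (X_laws k) n.
have VS k n : V n.+2 k = V n.+1 k + V n k + q * Psi_ n.+2 k :=
  inflation_variance p0_gt0 p1_gt0 p01 (X_laws k) n.
have Psi8 k n : 0 <= Psi_ n.+2 k <= 8 :=
  Psi_bound (E := E ^~ k) (ltW p0_gt0) (ltW p1_gt0) p01 (E0 k) (E1 k) (ES ^~ k) n.
have lim_bound k n := weighted_sum_lim (psi := Psi_ ^~ k) (Psi8 k) n.
have r1 : `|lambda1^-1| < 1 :> R.
  by rewrite gtr0_norm ?invr_gt0// invf_lt1.
split; first by move=> k; exact: (weighted_sum_cvg (psi := Psi_ ^~ k) (Psi8 k)).
split.
  move=> n k; rewrite /phi_ LseqE divr_ge0 ?exprn_ge0 ?(ltW l0)//.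
  exact: (variance_recursion_ge0 (V := V ^~ k) (psi := Psi_ ^~ k)
    q0 (V0 k) (V1 k) (Psi8 k) (VS k)).
split.
  (* The lower bound of the limit at index 0 is an empty sum, that is 0. *)
  move=> k; rewrite mulr_ge0//; have /andP[+ _] := lim_bound k 0%N.
  by rewrite big_geq.
split; last first.
  apply: (geometric_uniform_cvg (C := 8 * c * (1 + lambda1)) r1) => n k.
  rewrite exprVn /phi_ LseqE.
  exact: (variance_rate (V := V ^~ k) (psi := Psi_ ^~ k)
    q0 (V0 k) (V1 k) (Psi8 k) (VS k)).
have cS n : continuous (fun k => partial_sum k n).
  apply: continuous_partial_sum => m; apply: (continuous_Psi E).
  exact: ccontinuous_mean E0 E1 ES.
(* Continuity of [phi]: it is the uniform limit of the continuous scaled partial sums, with the tail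
   bound [lim_bound], whose constant is independent of [k], as rate. *)
apply: (@uniform_limit_continuous _ _ ((fun n k => c * partial_sum k n) @ \oo)).
  by exists 0%N => // n _ x; exact: (cvgM (cvg_cst c) (cS n x)).
apply: (geometric_uniform_cvg (C := c * (8 * lambda1 ^+ 2)) r1) => n k.
rewrite exprVn /phi -mulrBr normrM (ger0_norm c0) -mulrA ler_wpM2l// distrC.
by have /andP[lo hi] := lim_bound k n; rewrite ger0_norm ?subr_ge0 ?lerBlDl.
Qed.
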